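(* Let $X$ be an infinite set and let $G$ be a subgroup of $\operatorname{Sym}(X)$ with no algebraicity. Then $\mathfrak{Z}^{\pm}_{3}(G)$ is hyperconnected and thus non-discrete.
   Context: $\operatorname{Sym}(X)$ is the symmetric group on $X$ (all permutations of $X$, composed from left to right). Functions are written on the right of their arguments. For an infinite set $X$, a subgroup $G$ of $\operatorname{Sym}(X)$ has no algebraicity if for all finite $S\subseteq X$ and all $q\in X\setminus S$, the set $\{(q)g: g\in G \text{ such that } (x)g=x \text{ for all } x\in S\}$ is infinite. A topological space (or its topology) is hyperconnected if the intersection of any two nonempty open subsets is nonempty. For a group $G$, a function $f:G\to G$ is a group polynomial of degree $n$ if $(x)f=a_0x^{\varepsilon_1}a_1\cdots x^{\varepsilon_n}a_n$ for some $a_0,\ldots,a_n\in G$ and $\varepsilon_1,\ldots,\varepsilon_n\in\{-1,1\}$; constant functions are group polynomials of degree $0$. For $n\in\mathbb{N}$, $\mathfrak{Z}^{\pm}_n(G)$ is the topology on $G$ generated (as a subbase) by the sets $\{x\in G:(x)f\neq 1_G\}$, where $f$ is a group polynomial of degree at most $n$. *)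

(* Defs.v *)
From HB Require Import structures.
From mathcomp Require Import all_boot.
From mathcomp Require Import boolp classical_sets functions cardinality.
From mathcomp Require Import topology_structure.

Set Implicit Arguments.
Unset Strict Implicit.
Unset Printing Implicit Defensive.

Local Open Scope classical_set_scope.
Local Open Scope group_scope.

(* The inverse is stored as data; being unique, it adds nothing to the
   underlying bijection (see sym_eqP). *)
Record sym (X : Type) := Perm {
  sym_fun :> X -> X;
  sym_inv : X -> X;
  sym_funK : cancel sym_fun sym_inv;
  sym_invK : cancel sym_inv sym_fun
}.

Section SymGroup.
Variable X : Type.
Implicit Types f g h : sym X.

Lemma sym_eqP f g : f =1 g -> f = g.
Proof.
case: f g => [f f' fK f'K] [g g' gK g'K] /= fg.
have {}fg : f = g by apply/funext.
rewrite -{}fg in gK g'K *.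
have f'g' : f' = g' by apply/funext => x; rewrite -{1}(g'K x) fK.
rewrite -{}f'g' in gK g'K *.
by rewrite (Prop_irrelevance fK gK) (Prop_irrelevance f'K g'K).
Qed.

HB.instance Definition _ := gen_eqMixin (sym X).
HB.instance Definition _ := gen_choiceMixin (sym X).

Definition sym_one : sym X := @Perm X id id (fun=> erefl) (fun=> erefl).

Definition sym_opp f : sym X := Perm (@sym_invK _ f) (@sym_funK _ f).

(* Composition from left to right: f * g applies f first, so that f x stands
   for the right action (x)f. *)
Definition sym_mul f g : sym X :=
  Perm (can_comp (@sym_funK _ g) (@sym_funK _ f))
       (can_comp (@sym_invK _ f) (@sym_invK _ g)).

Let sym_mulA : associative sym_mul.
Proof. by move=> f g h; apply: sym_eqP. Qed.

Let sym_mul1 : left_id sym_one sym_mul.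
Proof. by move=> f; apply: sym_eqP. Qed.

Let sym_mulr1 : right_id sym_one sym_mul.
Proof. by move=> f; apply: sym_eqP. Qed.

Let sym_mulV : left_inverse sym_one sym_opp sym_mul.
Proof. by move=> f; apply: sym_eqP => x; apply: sym_invK. Qed.

Let sym_mulrV : right_inverse sym_one sym_opp sym_mul.
Proof. by move=> f; apply: sym_eqP => x; apply: sym_funK. Qed.

HB.instance Definition _ :=
  isGroup.Build (sym X) sym_mulA sym_mul1 sym_mulr1 sym_mulV sym_mulrV.

End SymGroup.

(* A subgroup, regarded as a group in its own right. *)
Definition subgroup_type (T : groupType) (G : groupClosed T) : Type :=
  {x : T | x \in G}.

Section SubgroupType.
Variables (T : groupType) (G : groupClosed T).

HB.instance Definition _ := SubChoice.on (subgroup_type G).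

Let subgroup_closed : group_closed (fun x : T => x \in G).
Proof. by split; [exact: gpred1 | exact: gpredF]. Qed.

HB.instance Definition _ :=
  SubChoice_isSubGroup.Build T _ (subgroup_type G) subgroup_closed.

End SubgroupType.

Definition no_algebraicity (X : Type) (G : groupClosed (sym X)) : Prop :=
  forall (S : set X) (q : X), finite_set S -> ~ S q ->
    infinite_set
      [set g q | g in [set g : sym X | g \in G /\ forall x, S x -> g x = x]].

(* f x = a_0 x^(eps_1) a_1 ... x^(eps_n) a_n, the boolean eps i being true
   when the exponent is -1 and false when it is 1. *)
Definition group_polynomial (G : groupType) (n : nat) (f : G -> G) : Prop :=
  exists (a : 'I_n.+1 -> G) (eps : 'I_n -> bool), forall x : G,
    f x = a ord0 *
      \prod_(i < n) ((if eps i then x^-1 else x) * a (lift ord0 i)).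

(* The carrier G endowed with the topology Z^{+-}_n(G). *)
Definition group_zariski (n : nat) (G : groupType) : Type := G.

Section GroupZariski.
Variables (n : nat) (G : groupType).

Definition group_zariski_subbase : set (set (group_zariski n G)) :=
  [set [set x | f x <> 1] | f in
    [set f : G -> G | exists2 m : nat, (m <= n)%N & group_polynomial m f]].

HB.instance Definition _ := Choice.copy (group_zariski n G) G.
HB.instance Definition _ :=
  @isSubBaseTopological.Build (group_zariski n G)
    (set (group_zariski n G)) group_zariski_subbase id.

End GroupZariski.

Definition hyperconnected (T : topologicalType) : Prop :=
  forall A B : set T, open A -> open B -> A !=set0 -> B !=set0 ->
    A `&` B !=set0.

Definition discrete (T : topologicalType) : Prop :=
  forall A : set T, open A.

(* Main.v *)
Require Import Defs.
From HB Require Import structures.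
From mathcomp Require Import all_boot.
From mathcomp Require Import boolp classical_sets functions cardinality.
From mathcomp Require Import topology_structure.

Set Implicit Arguments.
Unset Strict Implicit.
Unset Printing Implicit Defensive.

Local Open Scope classical_set_scope.

(** Only finitely many group polynomials are at stake in the intersection of two
basic open sets, so it suffices to find one element x of G that satisfies no
equation f(x) = 1 from a finite list of equations of degree at most 3, each of
which fails somewhere on G.

Among three cyclically consecutive signs two neighbours agree, so conjugating
turns f(x) = 1 into one of

  x^e = c,      x^e a = c x^d,      x^e a x^e = c x^d b

(see [generically_neq1]).  Evaluated at a point p of X, such an equation
compares the values of x and of its inverse at very few points: in the last
one, with r = (p)x^e and s = (p c)x^d, it says ((r)a)x^e = (s)b.  Therefore it
fails as soon as x moves points freshly, in the sense of [generic]: for a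
finite set F of points with signs and a finite set A of permutations, the
values of x^(+-1) prescribed by F are not related to one another, nor to the
points of F, by elements of A, and one further application of x^(+-1) again
leads outside the A-translates of these values.  The equation x^e a = c x^d
escapes this only if (p, e) = (p c, d) for all p, that is, if c = 1 and d = e;
then it says a = 1 and does not depend on x.

Having no algebraicity is what produces such elements.  If x in G has its
values fixed at finitely many points and t is not one of them, then
multiplying x on the left by elements of the pointwise stabiliser of these
points gives infinitely many values at t, so a finite set of values can be
avoided ([redirect]); iterating this over finitely many points
([redirect_all]), once for the points of F and once for the translates of
their values, yields a generic element ([generic_exists]).  Genericity is
antitone in F and A, so finitely many equations can be avoided simultaneously
by taking unions. *)

(** * Finite sets and signed powers *)

Lemma finite_set_ind (T : Type) (P : set T -> Prop) :
  P set0 ->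
  (forall x A, finite_set A -> P A -> P (x |` A)) ->
  forall A, finite_set A -> P A.
Proof.
elim/Pchoice: T => T in P *.
move=> P0 PU A /finite_seqP[s ->].
elim: s => [|x s IHs].
  by rewrite (_ : [set` _] = set0) //; apply/seteqP; split.
rewrite (_ : [set` _] = x |` [set` s]); last first.
  apply/seteqP; split => y /=; rewrite inE.
  - by case/orP => [/eqP|]; [left|right].
  - by case=> [->|->]; rewrite ?eqxx ?orbT.
by apply: PU => //; apply/finite_seqP; exists s.
Qed.

(** The boolean is the sign of the exponent, with the same convention as in
[group_polynomial]: true stands for -1. *)
Definition signed_power (H : groupType) (x : H) (e : bool) : H :=
  (if e then x^-1 else x)%g.

Lemma signed_powerK (H : groupType) (x : H) e :
  signed_power (signed_power x e) e = x.
Proof. by case: e => //=; rewrite /signed_power invgK. Qed.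

Lemma signed_powerN (H : groupType) (x : H) e :
  signed_power x (~~ e) = ((signed_power x e)^-1)%g.
Proof. by case: e => //=; rewrite /signed_power invgK. Qed.

Lemma signed_power_in (T : groupType) (G : groupClosed T) (x : T) e :
  x \in G -> signed_power x e \in G.
Proof. by case: e => //= xG; rewrite /signed_power gpredV. Qed.

(** In contrast with the generic morphism lemma, rewriting with this leaves the
projection in the form expected by [val_signed_power]. *)
Lemma val_mulg (T : groupType) (G : groupClosed T) (x y : subgroup_type G) :
  \val (x * y)%g = (\val x * \val y)%g.
Proof. exact: gmulfM. Qed.

Lemma val_signed_power (T : groupType) (G : groupClosed T)
    (x : subgroup_type G) e :
  \val (signed_power x e) = signed_power (\val x) e.
Proof. by case: e => //=; rewrite /signed_power gmulfV. Qed.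

(** * Redirecting an element of G at finitely many points *)

(** A pair (q, e) stands for the question where g^(+-1), with the sign e, sends
q; treating both signs alike makes g and its inverse play symmetric roles. *)
Definition signed_image (X : Type) (g : sym X) (s : X * bool) : X :=
  signed_power g s.2 s.1.

(** Knowing that g^e sends q to r is the same as knowing that g^(-e) sends r
to q: [flip g] passes from the first question to the second. *)
Definition flip (X : Type) (g : sym X) (s : X * bool) : X * bool :=
  (signed_image g s, ~~ s.2).

(** The answers of g to the questions in C do not already fix the answer to s:
an answer to c is also an answer to [flip g c], and to nothing else. *)
Definition undetermined (X : Type) (C : set (X * bool)) (g : sym X)
    (s : X * bool) : Prop :=
  forall c, C c -> c <> s /\ flip g c <> s.

(** Elements of the pointwise stabiliser of the finitely many points at which
g^e is constrained by C can be inserted before g^e without changing the answers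
to C.  Since G has no algebraicity they send t to infinitely many points, hence one of
them takes the answer to s = (t, e) out of E. *)
Lemma redirect (X : Type) (G : groupClosed (sym X)) (g : sym X)
    (C : set (X * bool)) (s : X * bool) (E : set X) :
  no_algebraicity G -> g \in G -> finite_set C -> undetermined C g s ->
  finite_set E ->
  exists h, [/\ h \in G,
    forall c, C c -> signed_image h c = signed_image g c &
    ~ E (signed_image h s)].
Proof.
case: s => t e noalg gG finC free finE.
pose D := [set if c.2 == e then c.1 else signed_image g c | c in C].
have Dt : ~ D t.
  case=> -[q d] Cq /=; case: eqP => [de|/eqP de] Eq.
  - by move: Cq; rewrite Eq de => /free[].
  - have [_] := free _ Cq; apply; rewrite /flip Eq /=.
    by congr pair; case: (d) (e) de => [] [].
have infK := noalg D t (finite_image _ finC) Dt.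
have [k [kG kfix] nE] : exists2 k : sym X,
    k \in G /\ (forall x, D x -> k x = x) & ~ E (signed_power g e (k t)).
  apply: contrapT => nex; apply: infK.
  apply: (@sub_finite_set _ _ (signed_power g (~~ e) @` E)); last first.
    exact: finite_image.
  move=> _ [k kP <-].
  exists (signed_power g e (k t)).
    by apply: contrapT => nE; apply: nex; exists k.
  by rewrite signed_powerN; exact: (@sym_funK _ (signed_power g e)).
exists (signed_power (k * signed_power g e)%g e); split.
- by apply: signed_power_in; rewrite gpredM //; apply: signed_power_in.
- move=> [q d] Cq; rewrite /signed_image /=.
  have : D (if d == e then q else signed_image g (q, d)) by exists (q, d).
  case: (d =P e) => [ede|/eqP de] /kfix kq.
    by rewrite ede signed_powerK [LHS]/= kq.
  have dE : d = ~~ e by move: de; case: (d); case: (e).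
  rewrite /signed_image /= dE in kq *.
  rewrite signed_powerN signed_powerK invgM -signed_powerN.
  rewrite -[RHS](@sym_funK _ k) kq //.
- by rewrite /signed_image /= signed_powerK.
Qed.

(** The set E is required to contain the points of T so that an answer already
given to a question of T never determines, through [flip], the answer to
another one. *)
Lemma redirect_all (X : Type) (G : groupClosed (sym X)) (g : sym X)
    (C T : set (X * bool)) (A : set (sym X)) (E : set X) :
  no_algebraicity G -> g \in G ->
  finite_set C -> finite_set T -> finite_set A -> finite_set E ->
  (forall t, T t -> undetermined C g t) -> fst @` T `<=` E ->
  exists h, [/\ h \in G, forall c, C c -> signed_image h c = signed_image g c,
    forall t, T t -> ~ E (signed_image h t) &
    forall t t' a, T t -> T t' -> A a -> t <> t' ->
      a (signed_image h t) <> signed_image h t'].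
Proof.
move=> noalg gG finC finT finA finE.
elim/finite_set_ind: finT => [|x {}T finT IHT] free TE.
  by exists g; split.
have [|t Tt|h [hG hC hE hA]] := IHT.
- by move=> t Tt; apply: free; right.
- by apply: TE; case: Tt => s Ts <-; exists s => //; right.
have [Tx|nTx] := pselect (T x).
  have TxT t : (x |` T) t -> T t by case=> [->|].
  exists h; split=> //; first by move=> t /TxT; exact: hE.
  by move=> t t' a /TxT Tt /TxT; exact: hA.
(* Both kinds of translates, as x may be on either side of the relation. *)
pose Eh := \bigcup_(a in A)
  ((a @` (signed_image h @` T)) `|` (sym_inv a @` (signed_image h @` T))).
have finEh : finite_set Eh.
  apply: bigcup_finite => // a Aa; rewrite finite_setU.
  by split; do 2!apply: finite_image.
have freeh : undetermined (C `|` T) h x.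
  move=> c [Cc|Tc].
    by rewrite /flip hC //; apply: free => //; left.
  split=> [cx|hc]; first by apply: nTx; rewrite -cx.
  by apply: (hE _ Tc); apply: TE; exists x; [left|rewrite -hc].
have [||k [kG kh kE]] := @redirect _ G h _ _ (E `|` Eh) noalg hG _ freeh.
- by rewrite finite_setU.
- by rewrite finite_setU.
have kT t : T t -> signed_image k t = signed_image h t.
  by move=> Tt; apply: kh; right.
exists k; split=> //.
- by move=> c Cc; rewrite kh ?hC //; left.
- by move=> t [->|Tt]; [move=> Ex; apply: kE; left|rewrite kT //; exact: hE].
- move=> t t' a [->|Tt] [->|Tt'] Aa // tt'.
  + rewrite (kT t') // => ax; apply: kE; right; exists a => //; right.
    exists (signed_image h t'); first by exists t'.
    by rewrite -ax sym_funK.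
  + rewrite (kT t) // => ax; apply: kE; right; exists a => //; left.
    by exists (signed_image h t) => //; exists t.
  + by rewrite !kT //; exact: hA.
Qed.

(** * Generic elements *)

(** Each condition is tailored to one shape of equation: the first one to
x^e = c, the second one to x^e a = c x^d, the third one to
x^e a x^e = c x^d b. *)
Definition generic (X : Type) (F : set (X * bool)) (A : set (sym X))
    (g : sym X) : Prop :=
  [/\ forall s s' a, F s -> F s' -> A a -> a (signed_image g s) <> s'.1,
      forall s s' a, F s -> F s' -> A a -> s <> s' ->
        a (signed_image g s) <> signed_image g s' &
      forall s s' a b, F s -> F s' -> A a -> A b ->
        signed_image g (a (signed_image g s), s.2) <> b (signed_image g s')].

Lemma generic_sub (X : Type) (F F' : set (X * bool)) (A A' : set (sym X)) g :
  F `<=` F' -> A `<=` A' -> generic F' A' g -> generic F A g.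
Proof.
move=> FF' AA' [g1 g2 g3]; split.
- by move=> s s' a /FF' Fs /FF' Fs' /AA'; exact: g1.
- by move=> s s' a /FF' Fs /FF' Fs' /AA'; exact: g2.
- by move=> s s' a b /FF' Fs /FF' Fs' /AA' Aa /AA'; exact: g3.
Qed.

(** The first two conditions are obtained by redirecting the identity at the
questions in F.  They ensure that the questions of the third condition, which
start from translates of the answers, are undetermined by F, so that a second
redirection can be made without disturbing the first one. *)
Lemma generic_exists (X : Type) (G : groupClosed (sym X))
    (F : set (X * bool)) (A : set (sym X)) :
  no_algebraicity G -> finite_set F -> finite_set A ->
  exists2 g : sym X, g \in G & generic F A g.
Proof.
move=> noalg finF finA.
pose E := (fst @` F) `|` \bigcup_(a in A) (sym_inv a @` (fst @` F)).
have finE : finite_set E.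
  rewrite finite_setU; split; first exact: finite_image.
  by apply: bigcup_finite => // a Aa; do 2!apply: finite_image.
have [||||g [gG _ gE gA]] :=
    @redirect_all _ G 1%g set0 F A E noalg _ _ finF finA finE.
- exact: gpred1.
- exact: finite_set0.
- by [].
- by left.
have g1 s s' a : F s -> F s' -> A a -> a (signed_image g s) <> s'.1.
  move=> Fs Fs' Aa ag; apply: (gE s Fs); right; exists a => //.
  by exists s'.1; [exists s'|rewrite -ag sym_funK].
(* The second round of questions, and the answers that they must avoid. *)
pose next (a : sym X) (s : X * bool) := (a (signed_image g s), s.2).
pose T := \bigcup_(a in A) (next a @` F).
pose E' := (fst @` T) `|` \bigcup_(a in A) (a @` (signed_image g @` F)).
have finT : finite_set T.
  by apply: bigcup_finite => // a Aa; apply: finite_image.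
have finE' : finite_set E'.
  rewrite finite_setU; split; first exact: finite_image.
  by apply: bigcup_finite => // a Aa; do 2!apply: finite_image.
have [t||h [hG hF hE _]] :=
    @redirect_all _ G g F T set0 E' noalg gG finF finT (finite_set0 _) finE'.
- case=> a Aa [s Fs <-] c Fc; split=> [cE|].
  + by apply: (g1 s c a) => //; rewrite cE.
  + rewrite /flip /next => -[gc cs]; apply: (gA s c a) => // sc.
    by move: cs; rewrite sc; case: (c.2).
- by left.
exists h => //; split.
- by move=> s s' a Fs Fs' Aa; rewrite hF //; exact: g1.
- by move=> s s' a Fs Fs' Aa; rewrite !hF //; exact: gA.
- move=> s s' a b Fs Fs' Aa Ab; rewrite (hF s) // (hF s') // => hs.
  apply: (hE (next a s)); first by exists a => //; exists s.
  rewrite hs; right; exists b => //.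
  by exists (signed_image g s') => //; exists s'.
Qed.

(** The filter on G generated by the sets of generic elements. *)
Definition generically (X : Type) (G : groupClosed (sym X))
    (P : set (subgroup_type G)) : Prop :=
  exists (F : set (X * bool)) (A : set (sym X)), [/\ finite_set F,
    finite_set A & forall g, generic F A (\val g) -> P g].

Lemma generically_sub (X : Type) (G : groupClosed (sym X))
    (P Q : set (subgroup_type G)) :
  P `<=` Q -> generically P -> generically Q.
Proof.
move=> PQ [F [A [finF finA FA]]]; exists F, A; split=> // g gen.
exact/PQ/FA.
Qed.

Lemma generically_bigcap (X : Type) (G : groupClosed (sym X)) (I : Type)
    (D : set I) (P : I -> set (subgroup_type G)) :
  finite_set D -> (forall i, D i -> generically (P i)) ->
  generically (\bigcap_(i in D) P i).
Proof.
move=> finD; elim/finite_set_ind: finD => [|i {}D finD IHD] genP.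
  exists set0, set0; split; [exact: finite_set0|exact: finite_set0|].
  by move=> g _ i.
have [|F [A [finF finA FA]]] := IHD.
  by move=> j Dj; apply: genP; right.
have [|F' [A' [finF' finA' FA']]] := genP i; first by left.
exists (F `|` F'), (A `|` A'); rewrite !finite_setU; split=> // g gen.
move=> j [->|Dj].
  apply: FA'; apply: generic_sub gen; exact: subsetUr.
apply: (FA g) => //; apply: generic_sub gen; exact: subsetUl.
Qed.

Lemma generically_ex (X : Type) (G : groupClosed (sym X))
    (P : set (subgroup_type G)) :
  no_algebraicity G -> generically P -> P !=set0.
Proof.
move=> noalg [F [A [finF finA FA]]].
have [g gG gen] := generic_exists noalg finF finA.
by exists (exist _ g gG); apply: FA.
Qed.

(** * Equations of degree at most three fail generically *)

Lemma generically_neq_power (X : Type) (G : groupClosed (sym X)) (p : X) e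
    (c : subgroup_type G) :
  generically [set x : subgroup_type G | signed_power x e <> c].
Proof.
exists [set (p, e); (\val c p, e)], [set 1%g].
split; [exact: finite_set2|exact: finite_set1|] => g [g1 _ _] /= gc.
apply: (g1 (p, e) (\val c p, e) 1%g) => //; [by left|by right|].
by rewrite /signed_image /= -gc val_signed_power.
Qed.

(** Two distinct questions (q, e) and (q c, d) have unrelated answers.  If no point
q makes them distinct, then c = 1 and d = e: the equation is a = 1, and one
element at which it fails shows that it fails everywhere. *)
Lemma generically_neq_deg2 (X : Type) (G : groupClosed (sym X)) (p : X) e d
    (a c : subgroup_type G) :
  (exists x : subgroup_type G,
    (signed_power x e * a <> c * signed_power x d)%g) ->
  generically [set x : subgroup_type G |
    (signed_power x e * a <> c * signed_power x d)%g].
Proof.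
move=> [x0 x0P].
have [[q qP]|noq] := pselect (exists q, (q, e) <> (\val c q, d)).
  exists [set (q, e); (\val c q, d)], [set \val a].
  split; [exact: finite_set2|exact: finite_set1|] => g [_ g2 _] /= gE.
  apply: (g2 (q, e) (\val c q, d) (\val a)) => //; [by left|by right|].
  move/(congr1 (fun u : subgroup_type G => \val u q)): gE.
  by rewrite !val_mulg !val_signed_power.
have qE q : (q, e) = (\val c q, d).
  by apply: contrapT => qP; apply: noq; exists q.
have ed : e = d by case: (qE p).
have c1 : c = 1%g.
  apply: val_inj; rewrite gmulf1; apply: sym_eqP => q.
  by case: (qE q).
exists set0, set0; split; [exact: finite_set0|exact: finite_set0|].
move=> g _ /=; rewrite c1 ed mul1g -[X in _ = X]mulg1 => /mulgI a1.
by apply: x0P; rewrite c1 ed a1 mul1g mulg1.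
Qed.

(** At p, the left-hand side is a second application of x^e, to the translate by
a of a fresh point; genericity keeps it away from the translates of all first
answers, that of the very same question included. *)
Lemma generically_neq_deg3 (X : Type) (G : groupClosed (sym X)) (p : X) e d
    (a b c : subgroup_type G) :
  generically [set x : subgroup_type G |
    (signed_power x e * a * signed_power x e <> c * signed_power x d * b)%g].
Proof.
exists [set (p, e); (\val c p, d)], [set \val a; \val b].
split; [exact: finite_set2|exact: finite_set2|] => g [_ _ g3] /= gE.
apply: (g3 (p, e) (\val c p, d) (\val a) (\val b)) => //;
  [by left|by right|by left|by right|].
move/(congr1 (fun u : subgroup_type G => \val u p)): gE.
by rewrite !val_mulg !val_signed_power.
Qed.

(** How an equation w = 1 is brought to a normal form u = v: k is the prefix of
w by which the word is rotated. *)
Lemma conj_div_eq1 (H : groupType) (k u v w : H) :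
  w = (k * (u * v^-1) * k^-1)%g -> w = 1%g -> u = v.
Proof.
move=> -> /(congr1 (fun z => k^-1 * z * k)%g).
rewrite !mulgA mulVg mul1g mulgVK mulg1 mulVg => /(congr1 (fun z => z * v)%g).
by rewrite mulgVK mul1g.
Qed.

Lemma generically_neq1 (X : Type) (G : groupClosed (sym X)) (p : X) m
    (f : subgroup_type G -> subgroup_type G) :
  m <= 3 -> group_polynomial m f -> (exists x, f x <> 1%g) ->
  generically [set x | f x <> 1%g].
Proof.
move=> m3 [a [eps fE]] nt.
case: m => [|[|[|[|//]]]] in m3 a eps fE *.
- exists set0, set0; split; [exact: finite_set0|exact: finite_set0|] => g _.
  by have [x] := nt; rewrite /= !fE !big_ord0.
- have [a0 [a1 [e {}fE]]] : exists a0 a1 e, forall x,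
      f x = (a0 * (signed_power x e * a1))%g.
    do 3!eexists; move=> x; rewrite fE !big_ord_recl big_ord0 mulg1.
    reflexivity.
  apply: generically_sub (generically_neq_power p e (a0^-1 * a1^-1)%g) => x /=.
  apply: contra_not; apply: (@conj_div_eq1 _ a0).
  by rewrite fE !invgM !invgK !mulgA mulgK.
- have [a0 [a1 [a2 [e1 [e2 {}fE]]]]] : exists a0 a1 a2 e1 e2, forall x,
      f x = (a0 * (signed_power x e1 * a1 * (signed_power x e2 * a2)))%g.
    do 5!eexists; move=> x; rewrite fE !big_ord_recl big_ord0 mulg1.
    reflexivity.
  have f1 x : f x = 1%g <->
      (signed_power x e1 * a1 =
        a0^-1 * a2^-1 * signed_power x (~~ e2))%g.
    rewrite signed_powerN; split.
      apply: (@conj_div_eq1 _ a0).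
      by rewrite fE !invgM !invgK !mulgA mulgK.
    by rewrite fE => ->; rewrite !mulgA mulgV mul1g mulgVK mulVg.
  apply: generically_sub (@generically_neq_deg2 _ _ p e1 (~~ e2) a1
    (a0^-1 * a2^-1)%g _) => [x /=|]; first by apply: contra_not => /f1.
  by have [x fx] := nt; exists x; apply: contra_not fx => /f1.
- have [a0 [a1 [a2 [a3 [e1 [e2 [e3 {}fE]]]]]]] :
      exists a0 a1 a2 a3 e1 e2 e3, forall x, f x =
        (a0 * (signed_power x e1 * a1 *
              (signed_power x e2 * a2 * (signed_power x e3 * a3))))%g.
    do 7!eexists; move=> x; rewrite fE !big_ord_recl big_ord0 mulg1.
    reflexivity.
  (* Two of three signs agree; rotate the word so that they come first. *)
  have [e12|[e23|e31]] : e1 = e2 \/ e2 = e3 \/ e3 = e1.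
    by case: (e1) (e2) (e3) => [] [] []; auto.
  + apply: generically_sub (generically_neq_deg3 p e1 (~~ e3) a1 a2^-1%g
      (a0^-1 * a3^-1)%g) => x /=.
    apply: contra_not; apply: (@conj_div_eq1 _ a0).
    by rewrite fE -e12 signed_powerN !invgM !invgK !mulgA mulgK.
  + apply: generically_sub (generically_neq_deg3 p e2 (~~ e1) a2
      (a0^-1 * a3^-1)%g a1^-1%g) => x /=.
    apply: contra_not; apply: (@conj_div_eq1 _ (a0 * signed_power x e1 * a1)%g).
    by rewrite fE -e23 signed_powerN !invgM !invgK !mulgA !(mulgK, mulgVK).
  + apply: generically_sub (generically_neq_deg3 p e3 (~~ e2) (a3 * a0)%g
      a1^-1%g a2^-1%g) => x /=.
    apply: contra_not; apply: (@conj_div_eq1 _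
      (a0 * signed_power x e1 * a1 * signed_power x e2 * a2)%g).
    by rewrite fE -e31 signed_powerN !invgM !invgK !mulgA !(mulgK, mulgVK).
Qed.

(** * Hyperconnectedness *)

Lemma open_generically (X : Type) (G : groupClosed (sym X)) (p : X)
    (U : set (group_zariski 3 (subgroup_type G))) :
  open U -> U !=set0 -> @generically X G U.
Proof.
move=> [D DB <-] [x [V DV Vx]].
have [S SB VE] := DB V DV.
apply: (@generically_sub _ _ V); first by move=> y Vy; exists V.
rewrite -VE; apply: generically_bigcap; first exact: finite_fset.
move=> W SW.
have := SB _ SW => /set_mem[f [m m3 fP] fW].
have : W x by move: Vx; rewrite -VE; apply.
rewrite /= -fW /= => fx.
by apply: (generically_neq1 p m3 fP); exists x.
Qed.

Theorem corollary1p13 (X : Type) (G : groupClosed (sym X)) :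
  infinite_set [set: X] ->
  no_algebraicity G ->
  hyperconnected (group_zariski 3 (subgroup_type G)) /\
  ~ discrete (group_zariski 3 (subgroup_type G)).
Proof.
move=> /infinite_setN0[p _] noalg.
have hyper : hyperconnected (group_zariski 3 (subgroup_type G)).
  move=> A B oA oB A0 B0.
  have genAB : @generically X G (\bigcap_(b in setT) if b then A else B).
    by apply: generically_bigcap => // -[] _; exact: open_generically.
  have [x xAB] := generically_ex noalg genAB.
  by exists x; split; [exact: (xAB true)|exact: (xAB false)].
split=> // disc.
(* In the discrete topology the identity and its complement would be open. *)
have [||x [/= x1 /(_ x1)]//] :=
    hyper [set 1%g] (~` [set 1%g]) (disc _) (disc _).
- by exists 1%g.
- have [x x1] := generically_ex noalg
    (generically_neq_power p false (1%g : subgroup_type G)).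
  by exists x.
Qed.
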